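(* If $G$ is a graph on $n \geq 2$ vertices, then (i) $2 \lceil \frac{n}{2} \rceil \leq \gamma_{ir}(G) + \gamma_{ir}(\bar{G}) \leq 2n-1$, (ii) $\left( \lceil \frac{n}{2} \rceil \right)^2 \leq \gamma_{ir}(G)\, \gamma_{ir}(\bar{G}) \leq n(n-1)$. Moreover, the following hold: (a) The bounds are attainable for any $n \geq 3$: for every integer $n \geq 3$ and each of the lower and upper bounds in (i) and (ii), there is a graph $G$ on $n$ vertices for which equality holds. (b) For each of (i) and (ii), the upper bound is attained if and only if $G$ is empty (has no edges) or complete.
   Context: All graphs are finite, simple and undirected. $\bar{G}$ denotes the complement of $G$. $N(v)$ denotes the set of neighbours of a vertex $v$. A dominating set of $G$ is a set $D \subseteq V(G)$ such that every vertex in $V(G)\setminus D$ has a neighbour in $D$. An irregular dominating set of $G$ is a dominating set $D$ of $G$ such that $|N(u) \cap D| \neq |N(v) \cap D|$ for every two distinct vertices $u, v \in V(G) \setminus D$ (in particular, $V(G)$ is one). The irregular domination number $\gamma_{ir}(G)$ is the size of a smallest irregular dominating set of $G$. *)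

(* Defs.v *)
From mathcomp Require Import all_boot.

Set Implicit Arguments.
Unset Strict Implicit.
Unset Printing Implicit Defensive.

Record sgraph (T : finType) := SGraph {
  adj :> rel T;
  adj_sym : symmetric adj;
  adj_irr : irreflexive adj
}.

Section Graph.
Variables (T : finType) (G : sgraph T).

Definition compl_adj : rel T := [rel x y | (x != y) && ~~ adj G x y].

Lemma compl_adj_sym : symmetric compl_adj.
Proof. by move=> x y; rewrite /compl_adj /= [y == x]eq_sym (adj_sym G y). Qed.

Lemma compl_adj_irr : irreflexive compl_adj.
Proof. by move=> x; rewrite /compl_adj /= eqxx. Qed.

Definition compl : sgraph T := SGraph compl_adj_sym compl_adj_irr.

Definition nbrs (v : T) : {set T} := [set u | adj G v u].

Definition dominating (D : {set T}) : bool :=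
  [forall v, (v \notin D) ==> [exists u in D, u \in nbrs v]].

Definition irregular_dominating (D : {set T}) : bool :=
  dominating D &&
  [forall u, forall v, [&& u \notin D, v \notin D & u != v] ==>
     (#|nbrs u :&: D| != #|nbrs v :&: D|)].

(* [set: T] is a legitimate default for the minimization, by
   irregular_dominatingT below. *)
Definition gamma_ir : nat :=
  #|[arg min_(D < [set: T] | irregular_dominating D) #|D|]|.

Lemma irregular_dominatingT : irregular_dominating [set: T].
Proof.
apply/andP; split; first by apply/forallP => v; rewrite inE.
by apply/forallP => u; apply/forallP => v; rewrite inE.
Qed.

Lemma gamma_irP :
  (exists2 D, irregular_dominating D & #|D| = gamma_ir) /\
  (forall D, irregular_dominating D -> gamma_ir <= #|D|).
Proof.
rewrite /gamma_ir; case: arg_minnP; first exact: irregular_dominatingT.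
by move=> D iD minD; split; first by exists D.
Qed.

Definition empty_graph : Prop := forall x y : T, ~~ adj G x y.

Definition complete_graph : Prop := forall x y : T, x != y -> adj G x y.

End Graph.

(* Main.v *)
(* A set D is irregular dominating iff the vertices outside D have distinct
   positive D-degrees; these lie in [1, #|D|], so #|D| >= n/2, while V minus one
   non-isolated vertex always qualifies. Hence gamma_ir G = n exactly when G has
   no edge, and gamma_ir = n - 1 for complete graphs. The lower bounds are
   attained by a half graph, slightly modified when n is even, in which two
   different sets of uphalf n vertices serve G and its complement. *)

Require Import Defs.
From mathcomp Require Import all_boot zify.

Set Implicit Arguments.
Unset Strict Implicit.
Unset Printing Implicit Defensive.

(** * Bounds for a single graph and its extreme values *)

Section IrregularDomination.
Variables (T : finType) (G : sgraph T).
Implicit Types D : {set T}.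

Lemma irregular_dominatingP D :
  reflect ((forall v, v \notin D -> 0 < #|nbrs G v :&: D|) /\
           {in ~: D &, injective (fun v => #|nbrs G v :&: D|)})
          (irregular_dominating G D).
Proof.
apply: (iffP andP) => [[/forallP dom /forallP irr] | [dom irr]]; split.
- move=> v vD; have /existsP[u /andP[uD uv]] := implyP (dom v) vD.
  by apply/card_gt0P; exists u; rewrite inE uv.
- move=> u v; rewrite !inE => uD vD /eqP E; apply/eqP; apply: contraLR E => uv.
  by have /forallP/(_ v) := irr u; rewrite uD vD uv.
- apply/forallP => v; apply/implyP => /dom/card_gt0P[u].
  by rewrite inE => /andP[uv uD]; apply/existsP; exists u; rewrite uD.
- apply/forallP => u; apply/forallP => v; apply/implyP => /and3P[uD vD].
  by apply: contra => /eqP E; apply/eqP/irr; rewrite ?inE.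
Qed.

Lemma gamma_ir_min D : irregular_dominating G D -> gamma_ir G <= #|D|.
Proof. by case: (gamma_irP G) => _; apply. Qed.

Lemma irregular_dominating_card D :
  irregular_dominating G D -> #|T| <= 2 * #|D|.
Proof.
case/irregular_dominatingP => dom irr.
suff: #|~: D| <= #|D| by rewrite -(cardsC D); lia.
(* The D-degree as an ordinal in [0..#|D|]. Domination excludes the value [ord0], so an injection
   from [~: D] leaves only [#|D|] possible values. *)
pose d (v : T) : 'I_#|D|.+1 := inord #|nbrs G v :&: D|.
have dE v : d v = #|nbrs G v :&: D| :> nat.
  by rewrite inordK // ltnS subset_leq_card // subsetIr.
have dinj : {in ~: D &, injective d}.
  by move=> u v uD vD /(congr1 val); rewrite /= !dE; apply: irr.
rewrite -(card_in_imset dinj).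
have: d @: (~: D) \subset [set~ ord0].
  apply/subsetP => _ /imsetP[v vD ->]; rewrite !inE -val_eqE /= dE -lt0n.
  by apply: dom; rewrite inE in vD.
by move/subset_leq_card; rewrite cardsC1 card_ord.
Qed.

Lemma gamma_ir_ge : uphalf #|T| <= gamma_ir G.
Proof.
case: (gamma_irP G) => -[D iD <-] _.
by have := irregular_dominating_card iD; lia.
Qed.

Lemma gamma_ir_edge x y : adj G x y -> gamma_ir G <= #|T|.-1.
Proof.
(* The set is [[set~ x]]: [y] dominates [x], and irregularity is vacuous with one vertex outside. *)
move=> xy; rewrite -(cardsC1 x); apply: gamma_ir_min.
apply/irregular_dominatingP; split=> [v | u v]; rewrite !inE !negbK.
  move=> /eqP ->; apply/card_gt0P; exists y; rewrite !inE xy /=.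
  by apply: contraTneq xy => ->; rewrite adj_irr.
by move=> /eqP -> /eqP ->.
Qed.

Lemma gamma_ir_empty : empty_graph G -> gamma_ir G = #|T|.
Proof.
move=> G0; case: (gamma_irP G) => -[D /irregular_dominatingP[dom _] <-] _.
suff ->: D = setT by rewrite cardsT.
apply/setP => v; rewrite inE; apply: contraT => /dom/card_gt0P[u].
by rewrite !inE (negPf (G0 v u)).
Qed.

Lemma gamma_ir_full : #|T| <= gamma_ir G -> 0 < #|T| -> empty_graph G.
Proof.
by move=> le_g T0 x y; apply/negP => /gamma_ir_edge; lia.
Qed.

(** Every vertex outside D is adjacent to all of D, so all outside D-degrees coincide and at most
    one vertex can be left out. *)
Lemma gamma_ir_complete : 2 <= #|T| -> complete_graph G -> gamma_ir G = #|T|.-1.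
Proof.
move=> T2 K; apply/eqP; rewrite eqn_leq; apply/andP; split.
  have /card_gt1P[x [y [_ _ xy]]] : 1 < #|[set: T]| by rewrite cardsT.
  exact: gamma_ir_edge (K x y xy).
case: (gamma_irP G) => -[D /irregular_dominatingP[_ irr] <-] _.
suff: #|~: D| <= 1 by rewrite -(cardsC D); lia.
have nbrsI v : v \in ~: D -> nbrs G v :&: D = D.
  rewrite inE => vD; apply/setIidPr/subsetP => u uD; rewrite inE; apply: K.
  by apply: contraNneq vD => ->.
by apply/card_le1_eqP => u v uD vD; apply: irr; rewrite // !nbrsI.
Qed.

End IrregularDomination.

(** * Upper bounds for a graph and its complement, with equality cases *)

Section Complement.
Variables (T : finType) (G : sgraph T).

Lemma complete_compl : complete_graph G <-> empty_graph (compl G).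
Proof.
split=> [K x y | E x y xy]; first by apply/negP => /andP[/K ->].
by have := E x y; rewrite /= /compl_adj /= xy negbK.
Qed.

Lemma empty_compl : empty_graph G -> complete_graph (compl G).
Proof. by move=> E x y xy; rewrite /= /compl_adj /= xy E. Qed.

Hypothesis T2 : 2 <= #|T|.

Lemma gamma_ir_compl_extremal : empty_graph G \/ complete_graph G ->
  gamma_ir G = #|T| /\ gamma_ir (compl G) = #|T|.-1 \/
  gamma_ir G = #|T|.-1 /\ gamma_ir (compl G) = #|T|.
Proof.
case=> [E | K]; [left | right].
  by rewrite gamma_ir_empty // (gamma_ir_complete T2 (empty_compl E)).
by rewrite (gamma_ir_complete T2 K) gamma_ir_empty //; apply/complete_compl.
Qed.

Lemma gamma_ir_compl_nonextremal : ~ (empty_graph G \/ complete_graph G) ->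
  gamma_ir G <= #|T|.-1 /\ gamma_ir (compl G) <= #|T|.-1.
Proof.
move=> NE; split; rewrite leqNgt; apply/negP => lt_g; apply: NE.
  by left; apply: gamma_ir_full; lia.
by right; apply/complete_compl; apply: gamma_ir_full; lia.
Qed.

(** Excluded middle for these [Prop] conditions, obtained constructively by comparing [gamma_ir] of
    [G] and of its complement with [#|T|]. *)
Lemma extremal_dec : empty_graph G \/ complete_graph G \/
  ~ (empty_graph G \/ complete_graph G).
Proof.
have [E | NE] := leqP #|T| (gamma_ir G); first by left; apply: gamma_ir_full; lia.
have [E | NE'] := leqP #|T| (gamma_ir (compl G)).
  by right; left; apply/complete_compl; apply: gamma_ir_full; lia.
by right; right; case/gamma_ir_compl_extremal; lia.
Qed.

Lemma nordhaus_gaddum_le :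
  gamma_ir G + gamma_ir (compl G) <= 2 * #|T| - 1 /\
  gamma_ir G * gamma_ir (compl G) <= #|T| * (#|T| - 1).
Proof.
have [E | [K | /gamma_ir_compl_nonextremal]] := extremal_dec.
- by case: (gamma_ir_compl_extremal (or_introl E)) => -[-> ->]; lia.
- by case: (gamma_ir_compl_extremal (or_intror K)) => -[-> ->]; lia.
- by nia.
Qed.

(** Extremal graphs give the values n and n - 1 in some order. Otherwise both values are at most n -
    1, so the sum is at most 2n - 2 and the product at most (n - 1)^2, both strictly below the
    bounds. *)
Lemma nordhaus_gaddum_eq :
  (gamma_ir G + gamma_ir (compl G) = 2 * #|T| - 1 <->
     empty_graph G \/ complete_graph G) /\
  (gamma_ir G * gamma_ir (compl G) = #|T| * (#|T| - 1) <->
     empty_graph G \/ complete_graph G).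
Proof.
split; split=> [eq_g | /gamma_ir_compl_extremal[] [-> ->]]; try lia.
  by have [|[|/gamma_ir_compl_nonextremal]] := extremal_dec; [left | right | lia].
by have [|[|/gamma_ir_compl_nonextremal]] := extremal_dec; [left | right | nia].
Qed.

End Complement.

(** * Sharpness of the lower bounds: the half graph *)

Lemma card_ord_interval n a b : b <= n -> #|[set x : 'I_n | a <= x < b]| = b - a.
Proof.
have card_lt c : c <= n -> #|[set x : 'I_n | x < c]| = c.
  by move=> cn; rewrite -sum1dep_card (big_ord_narrow cn) sum1_card card_ord.
move=> bn; have [ba | ab] := leqP b a.
  rewrite (_ : [set _ | _] = set0) ?cards0; first lia.
  by apply/setP => x; rewrite !inE; lia.
have -> : [set x : 'I_n | a <= x < b] =
          [set x : 'I_n | x < b] :\: [set x : 'I_n | x < a].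
  by apply/setP => x; rewrite !inE -leqNgt.
rewrite cardsD (setIidPr _) ?card_lt //; first lia.
by apply/subsetP => x; rewrite !inE; lia.
Qed.

Section HalfGraph.
Variable n : nat.
Let m := uphalf n.

(* The vertices i < m and m + j form a half graph: i is adjacent to m + j iff
   i <= j. The last vertex m + (m - 1), present only for even n, is also joined
   to every other m + j with j > 0. *)
Definition half_arc (x y : nat) : bool :=
  [&& x < m, m <= y & x + m <= y] || [&& m < x, x < 2 * m - 1 & y == 2 * m - 1].

Definition half_adj : rel 'I_n := [rel x y : 'I_n | half_arc x y || half_arc y x].

Lemma half_adj_sym : symmetric half_adj.
Proof. by move=> x y; rewrite /half_adj /= orbC. Qed.

Lemma half_adj_irr : irreflexive half_adj.
Proof. by move=> x; rewrite /half_adj /= /half_arc; lia. Qed.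

Definition half_graph : sgraph 'I_n := SGraph half_adj_sym half_adj_irr.

Hypothesis n3 : 3 <= n.

Let m_bounds : [&& 2 <= m, n <= 2 * m & 2 * m <= n.+1].
Proof. by rewrite /m; lia. Qed.

Lemma gamma_ir_half_graph : gamma_ir half_graph = m.
Proof.
have := gamma_ir_ge half_graph; rewrite card_ord -/m => ge_m.
apply/eqP; rewrite eqn_leq ge_m andbT.
(* The outside vertex [m + j] sees exactly [0..j] in D. The extra edges for even [n] lie outside D
   and change nothing. *)
pose D := [set x : 'I_n | 0 <= x < m].
have cD : #|D| = m by rewrite card_ord_interval; lia.
have degE (v : 'I_n) : v \notin D -> #|nbrs half_graph v :&: D| = (v - m).+1.
  rewrite inE => vD; have vn := ltn_ord v.
  rewrite (_ : _ :&: _ = [set x : 'I_n | 0 <= x < (v - m).+1]).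
    by rewrite card_ord_interval; lia.
  by apply/setP => x; rewrite !inE /= /half_adj /= /half_arc; lia.
rewrite -[leqRHS]cD; apply/gamma_ir_min/irregular_dominatingP.
split=> [v vD | u v]; first by rewrite degE.
rewrite !in_setC => uD vD; rewrite !degE //; move: uD vD; rewrite !inE => *.
by apply/val_inj => /=; lia.
Qed.

Lemma gamma_ir_compl_half_graph : gamma_ir (compl half_graph) = m.
Proof.
have := gamma_ir_ge (compl half_graph); rewrite card_ord -/m => ge_m.
apply/eqP; rewrite eqn_leq ge_m andbT.
pose I a b := [set x : 'I_n | a <= x < b].
(* In the complement, an outside [v < m] sees [0] and the vertices [m + j] with [j < v], hence has
   D-degree [v.+1]. As [0] is in D, these degrees are at least 2, leaving 1 free for the last vertex
   when [n] is even. *)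
pose D := I 0 1 :|: I m (2 * m - 1).
have cI2 a b : 0 < a -> b <= n -> #|I 0 1 :|: I a b| = (b - a).+1.
  move=> a0 bn; rewrite cardsU (_ : _ :&: _ = set0) ?cards0.
    by rewrite !card_ord_interval; lia.
  by apply/setP => x; rewrite !inE; lia.
have cD : #|D| = m by rewrite cI2; lia.
have degE (v : 'I_n) : v \notin D ->
    #|nbrs (compl half_graph) v :&: D| = if v < m then v.+1 else 1.
  rewrite !inE => vD; have vn := ltn_ord v; case: ifP => vm.
    rewrite (_ : _ :&: _ = I 0 1 :|: I m (m + v)); first by rewrite cI2; lia.
    by apply/setP => x; rewrite !inE /= /compl_adj /= /half_adj /= -val_eqE /= /half_arc; lia.
  (* Here [v] is [2 * m - 1]. It is joined to [0] in the half graph, and the extra edges join it to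
     all of D but [m], so [m] is its only complement neighbour in D. *)
  rewrite (_ : _ :&: _ = I m m.+1); first by rewrite card_ord_interval; lia.
  by apply/setP => x; rewrite !inE /= /compl_adj /= /half_adj /= -val_eqE /= /half_arc; lia.
rewrite -[leqRHS]cD; apply/gamma_ir_min/irregular_dominatingP.
split=> [v vD | u v]; first by rewrite degE //; case: ifP.
have [un vn] := (ltn_ord u, ltn_ord v).
rewrite !in_setC => uD vD; rewrite !degE //; move: uD vD; rewrite !inE.
by case: ifP => ?; case: ifP => ? *; apply/val_inj => /=; lia.
Qed.

End HalfGraph.

Definition edgeless_graph (T : finType) : sgraph T :=
  @SGraph T [rel _ _ | false] (fun _ _ => erefl) (fun _ => erefl).

Theorem theorem6p2 :
  (* (i) and (ii) *)
  (forall (n : nat) (T : finType) (G : sgraph T), #|T| = n -> 2 <= n ->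
     (2 * uphalf n <= gamma_ir G + gamma_ir (compl G) <= 2 * n - 1) /\
     (uphalf n ^ 2 <= gamma_ir G * gamma_ir (compl G) <= n * (n - 1))) /\
  (* (a) *)
  (forall n : nat, 3 <= n ->
     [/\ exists G : sgraph 'I_n,
           gamma_ir G + gamma_ir (compl G) = 2 * uphalf n,
         exists G : sgraph 'I_n,
           gamma_ir G + gamma_ir (compl G) = 2 * n - 1,
         exists G : sgraph 'I_n,
           gamma_ir G * gamma_ir (compl G) = uphalf n ^ 2 &
         exists G : sgraph 'I_n,
           gamma_ir G * gamma_ir (compl G) = n * (n - 1)]) /\
  (* (b) *)
  (forall (n : nat) (T : finType) (G : sgraph T), #|T| = n -> 2 <= n ->
     (gamma_ir G + gamma_ir (compl G) = 2 * n - 1 <->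
        empty_graph G \/ complete_graph G) /\
     (gamma_ir G * gamma_ir (compl G) = n * (n - 1) <->
        empty_graph G \/ complete_graph G)).
Proof.
split; [|split].
- move=> _ T G <- T2; have [le_s le_p] := nordhaus_gaddum_le G T2.
  rewrite le_s le_p !andbT mul2n -addnn -mulnn.
  by rewrite leq_add ?leq_mul ?gamma_ir_ge.
- move=> n n3.
  have n2 : 2 <= #|'I_n| by rewrite card_ord ltnW.
  have E : empty_graph (edgeless_graph 'I_n) by [].
  have [] := nordhaus_gaddum_eq (edgeless_graph 'I_n) n2.
  rewrite card_ord => eq_s eq_p.
  split; [exists (half_graph n) | exists (edgeless_graph 'I_n)
         | exists (half_graph n) | exists (edgeless_graph 'I_n)].
  + by rewrite gamma_ir_half_graph ?gamma_ir_compl_half_graph // addnn mul2n.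
  + by apply/eq_s; left.
  + by rewrite gamma_ir_half_graph ?gamma_ir_compl_half_graph.
  + by apply/eq_p; left.
- by move=> _ T G <- T2; apply: nordhaus_gaddum_eq.
Qed.
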